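(* Let $T\ge 2$ be an integer, let $p:\mathbb{Z}[0,T+1]\to\mathbb{R}$ be a map with $p^->1$ and $p^+>1$, where $p^-:=\min_{k\in\mathbb{Z}[0,T+1]}p(k)$ and $p^+:=\max_{k\in\mathbb{Z}[0,T+1]}p(k)$, and for every $k\in\mathbb{Z}[1,T]$ let $f_k:\mathbb{R}\to\mathbb{R}$ be a continuous function, with $F_k(t):=\int_0^t f_k(s)\,ds$ for $t\in\mathbb{R}$. Set $$A_0:=\liminf_{t\to0^+}\frac{\sum_{k=1}^T\max_{|\xi|\le t}F_k(\xi)}{t^{p^+}},\qquad B^0:=\limsup_{t\to0^+}\frac{\sum_{k=1}^TF_k(t)}{t^{p^-}},\qquad \kappa:=\frac{2^{p^+-1}p^-}{p^+(T+1)^{p^+-1}}.$$ Assume that $A_0<\kappa B^0$. Then, for each $$\lambda\in\left]\frac{2}{p^-B^0},\ \frac{2^{p^+}}{p^+(T+1)^{p^+-1}A_0}\right[,$$ the problem $$\begin{cases}-\Delta\big(|\Delta u(k-1)|^{p(k-1)-2}\Delta u(k-1)\big)=\lambda\, f_k(u(k)), & k\in\mathbb{Z}[1,T],\\ u(0)=u(T+1)=0,\end{cases}$$ admits a sequence of nonzero solutions which converges to zero.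
   Context: For integers $a<b$, $\mathbb{Z}[a,b]:=\{a,a+1,\dots,b\}$. The forward difference operator is $\Delta u(k-1):=u(k)-u(k-1)$; the left-hand side of the equation is $-\Delta(w(k-1))=-(w(k)-w(k-1))$ with $w(k-1)=|\Delta u(k-1)|^{p(k-1)-2}\Delta u(k-1)$, where $|s|^{q-2}s$ is read as $0$ at $s=0$. A solution is a function $u:\mathbb{Z}[0,T+1]\to\mathbb{R}$ satisfying the equation for every $k\in\mathbb{Z}[1,T]$ and the boundary conditions. Solutions lie in the finite-dimensional space $H=\{u:\mathbb{Z}[0,T+1]\to\mathbb{R}:\ u(0)=u(T+1)=0\}$ with norm $\|u\|=\big(\sum_{k=1}^{T+1}|\Delta u(k-1)|^2\big)^{1/2}$; convergence to zero is convergence to the zero function in this norm (equivalently in any norm on $H$). $]a,b[$ denotes an open interval. $A_0$ and $B^0$ are extended real numbers; the left endpoint is read as $0$ if $B^0=+\infty$, and the right endpoint as $+\infty$ if $A_0=0$. *)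

(* Defs.v *)
From HB Require Import structures.
From mathcomp Require Import all_boot all_order all_algebra.
From mathcomp Require Import all_classical all_reals all_analysis.

Set Implicit Arguments.
Unset Strict Implicit.
Unset Printing Implicit Defensive.

Import Order.TTheory GRing.Theory Num.Theory.
Import numFieldNormedType.Exports.

Local Open Scope classical_set_scope.
Local Open Scope ring_scope.

(* A function on Z[0, n] is a function on 'I_n.+1, so u lives on 'I_T.+2.
   The interior range Z[1, T] is 'I_T, the index i standing for k = i + 1. *)

(* [fdiff v i] is v(i + 1) - v(i). *)
Definition fdiff (R : realType) (n : nat) (v : 'I_n.+1 -> R) (i : 'I_n) : R :=
  v (lift ord0 i) - v (widen_ord (leqnSn n) i).

(* The node k = i + 1 of Z[0, T+1]. *)
Definition interior_node (T : nat) (i : 'I_T) : 'I_T.+2 :=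
  lift ord0 (widen_ord (leqnSn T) i).

(* |s|^(q-2) s; the factor s makes it 0 at s = 0 whatever q is. *)
Definition phi (R : realType) (q s : R) : R := `|s| `^ (q - 2) * s.

(* With k = j + 1 for j in Z[0, T]: |Delta u(k-1)|^(p(k-1)-2) Delta u(k-1). *)
Definition flux (R : realType) (T : nat) (p u : 'I_T.+2 -> R) (j : 'I_T.+1) :
    R :=
  phi (p (widen_ord (leqnSn T.+1) j)) (fdiff u j).

Definition is_solution (R : realType) (T : nat) (p : 'I_T.+2 -> R)
    (f : 'I_T -> R -> R) (lambda : R) (u : 'I_T.+2 -> R) : Prop :=
  [/\ forall i : 'I_T,
        - fdiff (flux p u) i = lambda * f i (u (interior_node i)),
      u ord0 = 0 & u ord_max = 0].

Definition normH (R : realType) (T : nat) (u : 'I_T.+2 -> R) : R :=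
  Num.sqrt (\sum_(j < T.+1) `|fdiff u j| ^+ 2).

Definition pmin (R : realType) (T : nat) (p : 'I_T.+2 -> R) : R :=
  \big[Num.min/p ord0]_(k < T.+2) p k.

Definition pmax (R : realType) (T : nat) (p : 'I_T.+2 -> R) : R :=
  \big[Num.max/p ord0]_(k < T.+2) p k.

(* The oriented integral of g from 0 to t; the library's integral is
   over a set, hence the case distinction. *)
Definition primitive0 (R : realType) (g : R -> R) (t : R) : R :=
  if 0 <= t then \int[@lebesgue_measure R]_(s in `[0, t]) g s
  else - \int[@lebesgue_measure R]_(s in `[t, 0]) g s.

(* For t >= 0 and g continuous the supremum below is attained. *)
Definition max_ball (R : realType) (g : R -> R) (t : R) : R :=
  sup [set g xi | xi in [set xi : R | `|xi| <= t]].

Definition A0 (R : realType) (T : nat) (p : 'I_T.+2 -> R)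
    (f : 'I_T -> R -> R) : \bar R :=
  limf_einf (fun t : R =>
    ((\sum_(i < T) max_ball (primitive0 (f i)) t) / t `^ pmax p)%:E) 0^'+.

Definition B0 (R : realType) (T : nat) (p : 'I_T.+2 -> R)
    (f : 'I_T -> R -> R) : \bar R :=
  limf_esup (fun t : R =>
    ((\sum_(i < T) primitive0 (f i) t) / t `^ pmin p)%:E) 0^'+.

Definition kappa (R : realType) (T : nat) (p : 'I_T.+2 -> R) : R :=
  (2 `^ (pmax p - 1) * pmin p) / (pmax p * T.+1%:R `^ (pmax p - 1)).

(* In \bar R the library sets 0^-1 = +oo and +oo^-1 = 0, so the endpoints
   below are 0 when B0 = +oo and +oo when A0 = 0. *)
Definition lambda_left (R : realType) (T : nat) (p : 'I_T.+2 -> R)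
    (f : 'I_T -> R -> R) : \bar R :=
  (2%:E / ((pmin p)%:E * B0 p f))%E.

Definition lambda_right (R : realType) (T : nat) (p : 'I_T.+2 -> R)
    (f : 'I_T -> R -> R) : \bar R :=
  ((2 `^ pmax p)%:E / ((pmax p * T.+1%:R `^ (pmax p - 1))%:E * A0 p f))%E.

(* Main.v *)
(* Solutions are critical points of
   E(u) = sum_k |Delta u(k-1)|^p(k-1) / p(k-1) - lambda sum_k F_k(u(k)),
   and E is minimised over the box |u(k)| <= t.  A path that leaves 0, reaches
   height t and comes back has total variation at least 2t, so for t <= 1/2 the
   power mean inequality bounds the first sum below by
   (2t)^p+ / (p+ (T+1)^(p+ - 1)) on the boundary of the box.  If t is one of
   the small values provided by the liminf A_0, this makes E >= 0 there.  The
   functions constantly equal to a small xi inside, with xi provided by the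
   limsup B^0, have E < 0, so the minimiser is interior, hence critical, and
   differs from 0, where E vanishes.  Letting t tend to 0 gives the sequence. *)

Require Import Defs.
From mathcomp Require Import all_boot all_order all_algebra.
From mathcomp Require Import all_classical all_reals all_analysis.
From mathcomp Require Import ring lra.

Set Implicit Arguments.
Unset Strict Implicit.
Unset Printing Implicit Defensive.

Import Order.TTheory GRing.Theory Num.Theory.
Import numFieldNormedType.Exports.
Local Open Scope classical_set_scope.
Local Open Scope ring_scope.

(** * Upper and lower limits as values met arbitrarily close to the limit point *)

Section Frequently.
Variables (R : realType) (h : R -> \bar R) (c : \bar R).

(** If [h] stayed at most [c] on [V], so would its supremum there, hence the limsup. This extracts a
    single small argument from a strict bound on $B^0$. *)
Lemma limf_esup_gt_frequently (F : set_system R) : (c < limf_esup h F)%E ->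
  forall V, F V -> exists2 t, V t & (c < h t)%E.
Proof.
move=> cF V FV; apply: contrapT => nex; move: cF; apply/negP; rewrite -leNgt.
apply: (@le_trans _ _ (ereal_sup (h @` V))).
  by apply: ereal_inf_lbound; exists V.
apply: ge_ereal_sup => _ [t Vt <-]; rewrite leNgt; apply/negP => ct.
by apply: nex; exists t.
Qed.

Lemma limf_einf_lt_frequently (F : set_system R) : (limf_einf h F < c)%E ->
  forall V, F V -> exists2 t, V t & (h t < c)%E.
Proof.
move=> cF V FV; apply: contrapT => nex; move: cF; apply/negP; rewrite -leNgt.
rewrite limf_einfE; apply: (@le_trans _ _ (ereal_inf (h @` V))).
  apply: le_ereal_inf_tmp => _ [t Vt <-]; rewrite leNgt; apply/negP => ct.
  by apply: nex; exists t.
by apply: ereal_sup_ubound; exists V.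
Qed.

End Frequently.

Lemma at_right0_itv (R : realType) (e : R) : 0 < e ->
  (0 : R)^'+ [set t | 0 < t < e].
Proof.
move=> e0; near=> t => /=; apply/andP; split; near: t.
- exact: nbhs_right_gt.
- exact: nbhs_right_lt.
Unshelve. all: by end_near. Qed.

(** * Derivatives of $F_k$ and of $|s|^q/q$, and the power mean inequality *)

Section Calculus.
Variable R : realType.
Local Notation mu := (@lebesgue_measure R).

(** A base point [a] to the left of 0 and [y] removes the case distinction on the sign of [y], so
    that the fundamental theorem of calculus applies across 0. *)
Lemma primitive0_sub (g : R -> R) (a y : R) : continuous g ->
  a <= 0 -> a <= y ->
  primitive0 g y =
  \int[mu]_(s in `[a, y]) g s - \int[mu]_(s in `[a, 0]) g s.
Proof.
move=> cg a0 ay.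
have ig b c : mu.-integrable `[b, c] (EFin \o g).
  apply: continuous_compact_integrable; first exact: segment_compact.
  exact: continuous_subspaceT.
have igo b c : mu.-integrable `]b, c] (EFin \o g).
  by apply: integrableS (ig b c) => //; exact: subset_itv_oc_cc.
rewrite /primitive0; case: leP => [y0|/ltW y0].
  by rewrite Rintegral_itvB ?bnd_simp// Rintegral_itv_obnd_cbnd.
by rewrite -opprB Rintegral_itvB ?bnd_simp// Rintegral_itv_obnd_cbnd.
Qed.

Lemma is_derive_primitive0 (g : R -> R) (x : R) : continuous g ->
  is_derive x 1 (primitive0 g) (g x).
Proof.
(* Strictly left of [x] and 0, so the shifted formula holds at every point near [x]. *)
move=> cg; pose a := Num.min x 0 - 1.
have ax : a < x by have : Num.min x 0 <= x;
  [rewrite ge_min lexx | rewrite /a; lra].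
have a0 : a < 0 by have : Num.min x 0 <= 0;
  [rewrite ge_min lexx orbT | rewrite /a; lra].
have xu : x < x + 1 by lra.
have ig : mu.-integrable `[a, x + 1] (EFin \o g).
  apply: continuous_compact_integrable; first exact: segment_compact.
  exact: continuous_subspaceT.
have [dG GE] := continuous_FTC1_closed xu ig ax (cg x).
set G := (fun x : R => _) in dG GE.
apply: (@near_eq_is_derive _ _ _ (G - cst (\int[mu]_(s in `[a, 0]) g s))).
- near=> y; rewrite (@primitive0_sub g a y) ?(ltW a0)//.
  by apply/ltW; near: y; exact: lt_nbhsr.
- rewrite -[g x]subr0 -GE derive1E.
  exact: is_deriveB (derivableP dG) (is_derive_cst _ _ _).
Unshelve. all: by end_near. Qed.

Lemma continuous_primitive0 (g : R -> R) : continuous g ->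
  continuous (primitive0 g).
Proof.
move=> cg x; apply/differentiable_continuous/derivable1_diffP.
by have [] := is_derive_primitive0 x cg.
Qed.

Lemma powR_norm_cvg0 (a : R) : 0 < a ->
  `|h : R| `^ a @[h --> 0^'] --> (0 : R).
Proof.
move=> a0; suff norm0 : `|h : R| @[h --> 0^'] --> (0 : R)^'+.
  exact: (cvg_comp _ _ norm0 (powR_cvg0 a0)).
move=> A [e /= e0 eA]; exists e => //= y ye y0; apply: eA => /=.
  by move: ye; rewrite /= !sub0r !normrN normr_id.
by rewrite normr_gt0.
Qed.

(** Away from 0 this is the power rule, reflected for negative [s]. At 0 the difference quotient has
    absolute value $|h|^{q-1}/q$, which tends to 0 because $q>1$. *)
Lemma is_derive_norm_powR (q s : R) : 1 < q ->
  is_derive s 1 (fun s => `|s| `^ q / q) (phi q s).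
Proof.
move=> q1; have q0 : 0 < q by lra.
have pos (x : R) : 0 < x -> is_derive x 1 (fun s => s `^ q / q) (x `^ (q - 1)).
  move=> x0; have := is_derive1_powR q x0 => d.
  have := @is_deriveZ _ _ _ _ q^-1 _ _ _ d.
  rewrite /GRing.scale /= mulKf ?gt_eqF// => {}d.
  by rewrite (_ : (fun s => _) = (fun s => q^-1 * s `^ q)) //;
    apply/funext => z; rewrite mulrC.
have phiE (x : R) : 0 < x -> phi q x = x `^ (q - 1).
  move=> x0; rewrite /phi gtr0_norm// -[X in _ * X = _]powRr1 ?ltW//.
  by rewrite -powRD ?(lt0r_neq0 x0) ?implybT//; congr (_ `^ _); lra.
case: (ltgtP s 0) => [s0|s0|->].
- have ns0 : 0 < - s by rewrite oppr_gt0.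
  apply: (@near_eq_is_derive _ _ _ ((fun s => s `^ q / q) \o -%R)).
  + near=> z; rewrite /= ltr0_norm//; near: z; exact: lt_nbhsl.
  + have -> : phi q s = phi q (- s) * - 1 by rewrite /phi normrN; ring.
    by rewrite phiE//; exact: is_derive1_comp (pos _ ns0) (is_deriveNid _ _).
- apply: (@near_eq_is_derive _ _ _ (fun s => s `^ q / q)).
  + near=> z; rewrite /= gtr0_norm//; near: z; exact: lt_nbhsr.
  + by rewrite phiE//; exact: pos.
- rewrite /phi mulr0; set G := (fun s => _).
  suff d : (fun h : R => h^-1 *: ((G \o shift 0) (h *: 1) - G 0)) @ (0 : R)^'
             --> (0 : R).
    by split; [apply/cvg_ex; exists 0; exact: d | exact: (cvg_lim _ d)].
  apply/norm_cvg0P.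
  apply: (@cvg_trans _ ((fun h : R => q^-1 * `|h| `^ (q - 1)) @ (0 : R)^'));
    last first.
    have q1' : 0 < q - 1 by lra.
    have c0 := cvgMl_tmp (a := q^-1) (powR_norm_cvg0 q1').
    by rewrite mulr0 in c0; exact: c0.
  apply: near_eq_cvg; near=> h.
  have h0 : h != 0 by near: h; exact: nbhs_dnbhs_neq.
  rewrite /G /= [h%:A]mulr1 addr0 normr0 powR0 ?gt_eqF// mul0r subr0
    /GRing.scale /=.
  rewrite !normrM !normfV (gtr0_norm q0) (ger0_norm (powR_ge0 _ _)).
  by rewrite -(mulr_powRB1 (normr_ge0 h) q0); field;
    rewrite normr_eq0 h0 gt_eqF.
Unshelve. all: by end_near. Qed.

Lemma continuous_norm_powR (q : R) : 1 < q ->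
  continuous (fun s : R => `|s| `^ q / q).
Proof.
move=> q1 x; apply/differentiable_continuous/derivable1_diffP.
by have [] := is_derive_norm_powR x q1.
Qed.

Lemma max_ball_ge (g : R -> R) (t x : R) : continuous g -> `|x| <= t ->
  g x <= max_ball g t.
Proof.
move=> cg xt; apply: ub_le_sup; last by exists x.
have t0 : - t <= t by have := normr_ge0 x; lra.
(* The supremum is an upper bound only if the set is bounded above; the extreme value theorem on
   $[-t,t]$ ensures this. *)
have [c _ hc] := @EVT_max R g (- t) t t0 (continuous_subspaceT cg).
exists (g c) => _ [y /= yt <-]; apply: hc.
by rewrite in_itv /= -ler_norml.
Qed.

Lemma primitive00 (g : R -> R) : primitive0 g 0 = 0.
Proof. by rewrite /primitive0 lexx set_itv1 Rintegral_set1. Qed.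

Lemma powR_sum_le (I : finType) (a : I -> R) (q : R) : 1 < q ->
  (0 < #|I|)%N -> (forall i, 0 <= a i) ->
  (\sum_i a i) `^ q <= #|I|%:R `^ (q - 1) * \sum_i a i `^ q.
Proof.
move=> q1 I0 a0; have q0 : 0 < q by lra.
have n0 : (0 : R) < #|I|%:R by rewrite ltr0n.
set S := \sum_i a i; have S0 : 0 <= S by apply: sumr_ge0.
pose m := S / #|I|%:R.
have m0 : 0 <= m by rewrite divr_ge0// ltW.
(* Tangent line to s^q at the mean m; it is summed over i. *)
have young i : q * (a i * m `^ (q - 1)) <= a i `^ q + (q - 1) * m `^ q.
  have q1' : 0 < q - 1 by lra.
  (* Young's inequality with exponents $q$ and $q/(q-1)$, for which $(m^{q-1})^{q/(q-1)}=m^q$;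
     multiplied by $q$ it is the tangent line bound. *)
  have := @conjugate_powR R (a i) (m `^ (q - 1)) q (q / (q - 1)) (a0 i)
    (powR_ge0 _ _) q0 (divr_gt0 q0 q1') _.
  rewrite -powRrM mulrCA mulfV ?gt_eqF// mulr1.
  have -> : q^-1 + (q / (q - 1))^-1 = 1 by field; rewrite !gt_eqF.
  move=> /(_ erefl); rewrite -(ler_pM2l q0) => /le_trans; apply.
  by rewrite le_eqVlt; apply/orP; left; apply/eqP; field; rewrite !gt_eqF.
have : \sum_i q * (a i * m `^ (q - 1)) <= \sum_i (a i `^ q + (q - 1) * m `^ q).
  by apply: ler_sum => i _; exact: young.
rewrite -mulr_sumr -mulr_suml big_split /= sumr_const.
rewrite -[X in _ <= _ + X]mulr_natl -/S.
have -> : S = #|I|%:R * m by rewrite /m; field; rewrite gt_eqF.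
rewrite -[#|I|%:R * m * _]mulrA mulr_powRB1// => H.
(* With $n$ terms the left side of the sum is $q\,n\,m^q$, so cancelling $(q-1)\,n\,m^q$ leaves
   this; multiplying by $n^{q-1}$ then makes the left side $(nm)^q$. *)
have {}H : #|I|%:R * m `^ q <= \sum_i a i `^ q by lra.
rewrite (powRM _ (ltW n0) m0) -(mulr_powRB1 (ltW n0) q0) [#|I|%:R * _]mulrC
  -mulrA.
by rewrite ler_wpM2l ?powR_ge0.
Qed.

End Calculus.

(** Cut at [k], the sum splits into two halves, and the triangle inequality for a telescoping sum
    bounds each from below. *)
Lemma variation_ge (R : realType) (n : nat) (u : 'I_n.+1 -> R) (k : 'I_n.+1) :
  `|u k - u ord0| + `|u ord_max - u k| <= \sum_j `|fdiff u j|.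
Proof.
pose v m := u (inord m).
have vE (i : 'I_n.+1) : v i = u i by rewrite /v inord_val.
have -> : \sum_j `|fdiff u j| = \sum_(0 <= m < n) `|v m.+1 - v m|.
  rewrite big_mkord; apply: eq_bigr => j _; rewrite /fdiff -!vE /=.
  by rewrite /bump leq0n.
have kn : (k <= n)%N by rewrite -ltnS.
rewrite (big_cat_nat (leq0n k) kn) /= -!vE /=.
by apply: lerD; rewrite -telescope_sumr// ler_norm_sum.
Qed.

(** * The space $H$ in coordinates: vectors of interior values *)

Section ZeroExtension.
Variables (R : realType) (T : nat).

(** $H$ is encoded by row vectors of length [T], where compactness of boxes and continuity of
    coordinates are at hand; the boundary conditions hold by construction. Entry [i] sits at node
    [i + 1]. *)
Definition zero_ext (x : 'rV[R]_T) (k : 'I_T.+2) : R :=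
  if unlift ord0 k is Some j then
    if unlift ord_max j is Some i then x ord0 i else 0
  else 0.

Lemma interior_nodeE (i : 'I_T) : interior_node i = lift ord0 (lift ord_max i).
Proof. by congr lift; apply/val_inj/esym/lift_max. Qed.

Lemma zero_ext0 x : zero_ext x ord0 = 0.
Proof. by rewrite /zero_ext unlift_none. Qed.

Lemma zero_ext_max x : zero_ext x ord_max = 0.
Proof.
have -> : ord_max = lift ord0 ord_max :> 'I_T.+2 by apply: val_inj.
by rewrite /zero_ext liftK unlift_none.
Qed.

Lemma zero_ext_interior x i : zero_ext x (interior_node i) = x ord0 i.
Proof.
by rewrite /zero_ext interior_nodeE !liftK.
Qed.

Variant node_spec : 'I_T.+2 -> Prop :=
  | NodeLeft : node_spec ord0
  | NodeRight : node_spec ord_max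
  | NodeInterior i : node_spec (interior_node i).

Lemma nodeP k : node_spec k.
Proof.
case: (unliftP ord0 k) => [j ->|->]; last exact: NodeLeft.
case: (unliftP ord_max j) => [i ->|->].
  by rewrite -interior_nodeE; exact: NodeInterior.
have <- : ord_max = lift ord0 ord_max :> 'I_T.+2 by apply: val_inj.
exact: NodeRight.
Qed.

Lemma zero_ext_line (x y : 'rV[R]_T) (h : R) k :
  zero_ext (x + h *: y) k = zero_ext x k + h * zero_ext y k.
Proof.
case: (nodeP k) => [||i]; rewrite ?zero_ext0 ?zero_ext_max ?zero_ext_interior.
- by rewrite mulr0 addr0.
- by rewrite mulr0 addr0.
- by rewrite !mxE.
Qed.

Lemma fdiff_zero_ext_line (x y : 'rV[R]_T) (h : R) j :
  fdiff (zero_ext (x + h *: y)) j =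
    fdiff (zero_ext x) j + h * fdiff (zero_ext y) j.
Proof. by rewrite /fdiff !zero_ext_line; ring. Qed.

Lemma zero_ext_le (x : 'rV[R]_T) (t : R) : 0 <= t ->
  (forall i, `|x ord0 i| <= t) -> forall k, `|zero_ext x k| <= t.
Proof.
move=> t0 xt k; case: (nodeP k) => [||i].
- by rewrite zero_ext0 normr0.
- by rewrite zero_ext_max normr0.
- by rewrite zero_ext_interior.
Qed.

Lemma fdiff_zero_ext_le (x : 'rV[R]_T) (t : R) : 0 <= t ->
  (forall i, `|x ord0 i| <= t) -> forall j, `|fdiff (zero_ext x) j| <= 2 * t.
Proof.
move=> t0 xt j; rewrite /fdiff (le_trans (ler_normB _ _))//.
by rewrite mulr2n mulrDl mul1r lerD// zero_ext_le.
Qed.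

Lemma zero_ext_delta (i : 'I_T) k :
  zero_ext (delta_mx ord0 i) k = (k == interior_node i)%:R.
Proof.
case: (nodeP k) => [||i'].
- by rewrite zero_ext0.
- rewrite zero_ext_max; case: eqP => // /(congr1 val) /=.
  by rewrite /bump leq0n add1n => -[] /eqP; rewrite eq_sym ltn_eqF.
- by rewrite zero_ext_interior mxE eqxx.
Qed.

(** Summation by parts against a coordinate vector: its extension jumps by 1 on the edge entering
    node [i + 1] and by -1 on the edge leaving it. This produces the left side of the equation. *)
Lemma sum_fdiff_zero_ext_delta (i : 'I_T) (w : 'I_T.+1 -> R) :
  \sum_j w j * fdiff (zero_ext (delta_mx ord0 i)) j = - fdiff w i.
Proof.
under eq_bigr => j _.
  rewrite /fdiff !zero_ext_delta (inj_eq (@lift_inj _ _)).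
  have -> : (widen_ord (leqnSn T.+1) j == interior_node i) = (j == lift ord0 i).
    by rewrite -!val_eqE.
  rewrite mulrBr; over.
rewrite sumrB (bigD1 (widen_ord (leqnSn T) i)) //= eqxx mulr1 big1 ?addr0;
  last first.
  by move=> j /negPf ->; rewrite mulr0.
rewrite (bigD1 (lift ord0 i)) //= eqxx mulr1 big1 ?addr0; last first.
  by move=> j /negPf ->; rewrite mulr0.
by rewrite /fdiff opprB.
Qed.

(** Small constant vectors will serve as test functions of negative energy; their two end jumps are
    the source of the 2 in the left endpoint for [lambda]. *)
Lemma fdiff_zero_ext_const (c : R) (j : 'I_T.+1) :
  fdiff (zero_ext (const_mx c)) j = c * ((j == ord0)%:R - (j == ord_max)%:R).
Proof.
have cE k : zero_ext (const_mx c) k = c * ((k != ord0) && (k != ord_max))%:R.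
  case: (nodeP k) => [||i].
  - by rewrite zero_ext0 mulr0.
  - by rewrite zero_ext_max eqxx andbF mulr0.
  - rewrite zero_ext_interior mxE -!val_eqE /= /bump leq0n add1n eqSS.
    by rewrite ltn_eqF// mulr1.
rewrite /fdiff !cE -!val_eqE /= /bump leq0n add1n eqSS.
rewrite [(j == T.+1 :> nat)]ltn_eqF//.
by case: (_ == _); case: (_ == _) => /=; ring.
Qed.

Lemma continuous_zero_ext k : continuous (fun x : 'rV[R]_T => zero_ext x k).
Proof.
case: (nodeP k) => [||i].
- by under eq_fun do rewrite zero_ext0; exact: cst_continuous.
- by under eq_fun do rewrite zero_ext_max; exact: cst_continuous.
- by under eq_fun do rewrite zero_ext_interior; exact: coord_continuous.
Qed.

End ZeroExtension.

(** * The energy and its minimisers over a box *)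

Section Energy.
Variables (R : realType) (T : nat) (p : 'I_T.+2 -> R) (f : 'I_T -> R -> R).
Hypothesis p1 : forall k, 1 < p k.
Hypothesis cf : forall i, continuous (f i).

Definition dissipation (x : 'rV[R]_T) : R :=
  \sum_(j < T.+1) `|fdiff (zero_ext x) j| `^ p (widen_ord (leqnSn T.+1) j)
                  / p (widen_ord (leqnSn T.+1) j).

Definition potential (x : 'rV[R]_T) : R :=
  \sum_(i < T) primitive0 (f i) (x ord0 i).

Variable lambda : R.

Definition energy (x : 'rV[R]_T) : R := dissipation x - lambda * potential x.

Lemma energy0 : energy 0 = 0.
Proof.
rewrite /energy /dissipation /potential big1 => [|j _]; last first.
  have -> : fdiff (zero_ext (0 : 'rV[R]_T)) j = 0.
    have := fdiff_zero_ext_line (0 : 'rV[R]_T) 0 1 j.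
    by rewrite scaler0 addr0; lra.
  by rewrite normr0 powR0 ?mul0r// gt_eqF// (lt_trans ltr01).
by rewrite big1 ?mulr0 ?subr0// => i _; rewrite mxE primitive00.
Qed.

Lemma continuous_dissipation : continuous dissipation.
Proof.
apply: (@continuous_big R _ +%R 0 _ (@add_continuous R)) => j _ x.
apply: (@continuous_comp _ _ _ (fun x => fdiff (zero_ext x) j)
          (fun s => `|s| `^ _ / _)).
  exact: cvgB (@continuous_zero_ext R T _ x) (@continuous_zero_ext R T _ x).
exact: (@continuous_norm_powR R _ (p1 _)).
Qed.

Lemma continuous_potential : continuous potential.
Proof.
apply: (@continuous_big R _ +%R 0 _ (@add_continuous R)) => i _ x.
apply: (@continuous_comp _ _ _ (fun x : 'rV[R]_T => x ord0 i)).
  exact: coord_continuous.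
exact: continuous_primitive0.
Qed.

Lemma continuous_energy : continuous energy.
Proof.
move=> x; apply: (cvgB (@continuous_dissipation x)).
exact: cvgMl_tmp (@continuous_potential x).
Qed.

(** The partial derivative is the residual of the equation at node [i + 1]: the chain rule is
    applied term by term, followed by summation by parts. *)
Lemma is_derive_energy (x : 'rV[R]_T) (i : 'I_T) (h : R) :
  is_derive h 1 (fun h => energy (x + h *: delta_mx ord0 i))
    (- fdiff (flux p (zero_ext (x + h *: delta_mx ord0 i))) i
     - lambda * f i ((x + h *: delta_mx ord0 i) ord0 i)).
Proof.
set e := delta_mx ord0 i.
have aff (a b : R) : is_derive h 1 (fun h => a + h * b) b.
  have := is_deriveD (is_derive_cst a h 1) (is_deriveM (is_derive_id h 1)
    (is_derive_cst b h 1)).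
  by rewrite add0r /= scaler0 add0r /cst /GRing.scale /= mulr1.
have dP : is_derive h 1 (fun h => dissipation (x + h *: e))
    (- fdiff (flux p (zero_ext (x + h *: e))) i).
  rewrite -sum_fdiff_zero_ext_delta.
  have -> : (fun h => dissipation (x + h *: e)) =
      \sum_(j < T.+1) (fun h => `|fdiff (zero_ext (x + h *: e)) j|
         `^ p (widen_ord (leqnSn T.+1) j) / p (widen_ord (leqnSn T.+1) j)).
    by apply/funext => y; rewrite fct_sumE.
  apply: is_derive_sum => j.
  under eq_fun do rewrite fdiff_zero_ext_line.
  rewrite {1}/flux fdiff_zero_ext_line.
  exact: (@is_derive1_comp _ (fun s => `|s| `^ _ / _)
    (fun h => fdiff (zero_ext x) j + h * fdiff (zero_ext e) j) _ _ _
    (is_derive_norm_powR _ (p1 _)) (aff _ _)).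
have dQ : is_derive h 1 (fun h => potential (x + h *: e))
    (f i ((x + h *: e) ord0 i)).
  (* Padding with vanishing terms gives a sum that matches [potential] term by term. *)
  have -> : f i ((x + h *: e) ord0 i) =
      \sum_(k < T) f k ((x + h *: e) ord0 k) * e ord0 k.
    rewrite (bigD1 i)//= big1 ?addr0; last first.
      by move=> k ki; rewrite [e _ _]mxE (negPf ki) andbF mulr0.
    by rewrite [e _ _]mxE !eqxx mulr1.
  have -> : (fun h => potential (x + h *: e)) =
      \sum_(k < T) (fun h => primitive0 (f k) ((x + h *: e) ord0 k)).
    by apply/funext => y; rewrite fct_sumE.
  apply: is_derive_sum => k.
  have E : (fun h : R => (x + h *: e) ord0 k) =
      (fun h => x ord0 k + h * e ord0 k).
    by apply/funext => y; rewrite !mxE.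
  apply: (@is_derive1_comp _ (primitive0 (f k)) (fun h => (x + h *: e) ord0 k)).
    exact: is_derive_primitive0.
  by rewrite E; exact: aff.
exact: is_deriveB dP (is_deriveZ lambda dQ).
Qed.

(** From a point strictly inside the box one can move both ways along each coordinate, so Fermat's
    rule makes every partial derivative vanish. *)
Lemma box_min_is_solution (t : R) (x : 'rV[R]_T) :
  (forall i, `|x ord0 i| < t) ->
  (forall y : 'rV[R]_T, (forall i, `|y ord0 i| <= t) -> energy x <= energy y) ->
  is_solution p f lambda (zero_ext x).
Proof.
move=> xt xmin; split=> [i||]; [|exact: zero_ext0|exact: zero_ext_max].
pose e : 'rV[R]_T := delta_mx ord0 i; pose J (h : R) := energy (x + h *: e).
(* The room left in coordinate [i]: shifts smaller than [d] stay in the box. *)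
pose d := t - `|x ord0 i|; have d0 : 0 < d by rewrite subr_gt0.
have J0 : J 0 = energy x by rewrite /J scale0r addr0.
have d00 : (0 : R) \in `]- d, d[%R by rewrite in_itv /= oppr_lt0 d0.
have dd : - d <= d by lra.
have [||_ J0'] := @derive1_at_min R J (- d) d 0 dd _ d00.
- by move=> h _; have [] := is_derive_energy x i h.
- move=> h; rewrite in_itv /= => hd; rewrite J0; apply: xmin => k.
  rewrite !mxE eqxx /=; case: eqP => [->|_]; last by rewrite mulr0 addr0 ltW.
  rewrite mulr1 (le_trans (ler_normD _ _))//.
  have : `|h| < d by rewrite ltr_norml.
  by rewrite /d; lra.
have [_] := is_derive_energy x i 0.
rewrite -/e -/J J0' scale0r addr0 zero_ext_interior => /eqP.
by rewrite eq_sym subr_eq0 => /eqP.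
Qed.

(** A minimiser over the compact box has negative energy, which excludes both the boundary and the
    origin. *)
Lemma exists_box_solution (t : R) : 0 < t ->
  (forall x : 'rV[R]_T, (forall i, `|x ord0 i| <= t) ->
     (exists i, `|x ord0 i| = t) -> 0 <= energy x) ->
  (exists2 x : 'rV[R]_T, (forall i, `|x ord0 i| <= t) & energy x < 0) ->
  exists x : 'rV[R]_T, [/\ forall i, `|x ord0 i| <= t, x != 0
    & is_solution p f lambda (zero_ext x)].
Proof.
move=> t0 bnd [v vt v0].
pose A := [set x : 'rV[R]_T | forall i, `[- t, t]%classic (x ord0 i)].
have AE (x : 'rV[R]_T) : A x <-> forall i, `|x ord0 i| <= t.
  by split => Ax i; have := Ax i; rewrite /= in_itv /= ler_norml.
have cA : compact A :=
  (@rV_compact _ _ (fun=> `[- t, t]%classic) (fun=> @segment_compact R _ _)).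
have A0 : A !=set0 by exists v; apply/AE.
have [x xA xmin] := EVT_min_rV A0 cA (continuous_subspaceT continuous_energy).
have {}xA : forall i, `|x ord0 i| <= t by apply/AE; rewrite inE in xA.
have {}xmin (y : 'rV[R]_T) :
    (forall i, `|y ord0 i| <= t) -> energy x <= energy y.
  by move=> /AE yA; apply: xmin; rewrite inE.
have x0 : energy x < 0 := le_lt_trans (xmin v vt) v0.
exists x; split=> //.
  by apply/eqP => xE; move: x0; rewrite xE energy0 ltxx.
apply: (@box_min_is_solution t) => // i; rewrite lt_neqAle xA andbT.
by apply/eqP => xit; move: x0; rewrite ltNge bnd//; exists i.
Qed.

End Energy.

(** Neither $a^s$ nor $1/s$ increases with $s>0$ when $0\le a\le1$. This replaces the variable
    exponents by $p^+$ in lower bounds and by $p^-$ in upper bounds. *)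
Lemma ler_powR_div (R : realType) (a q r : R) :
  0 <= a <= 1 -> 0 < r -> r <= q ->
  a `^ q / q <= a `^ r / r.
Proof.
move=> /andP[]; rewrite le_eqVlt => /predU1P[<- _ r0 rq|a0 a1 r0 rq].
  by rewrite !powR0 ?gt_eqF ?mul0r// (lt_le_trans r0).
have q0 : 0 < q := lt_le_trans r0 rq.
apply: ler_pM; rewrite ?powR_ge0 ?invr_ge0 ?(ltW q0)//.
  by apply: ger_powR => //; rewrite a0 a1.
by rewrite lef_pV2.
Qed.

(** * Bounds on the dissipation and on the norm *)

Section Bounds.
Variables (R : realType) (T : nat) (p : 'I_T.+2 -> R).

Lemma pmin_le k : pmin p <= p k.
Proof. exact: bigmin_le_cond. Qed.

Lemma le_pmax k : p k <= pmax p.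
Proof. exact: le_bigmax_cond. Qed.

Hypothesis pmin1 : 1 < pmin p.

Lemma pmin_gt1 k : 1 < p k.
Proof. exact: lt_le_trans pmin1 (pmin_le k). Qed.

Lemma pmax_gt1 : 1 < pmax p.
Proof. exact: lt_le_trans (pmin_gt1 ord0) (le_pmax ord0). Qed.

Lemma dissipation_ge (t : R) (x : 'rV[R]_T) : 0 < t -> t <= 2^-1 ->
  (forall i, `|x ord0 i| <= t) -> (exists i, `|x ord0 i| = t) ->
  2 `^ pmax p / (pmax p * T.+1%:R `^ (pmax p - 1)) * t `^ pmax p
    <= dissipation p x.
Proof.
move=> t0 t12 xt [i xit]; set q := pmax p.
have q1 : 1 < q := pmax_gt1.
have q0 : 0 < q by lra.
set N : R := T.+1%:R `^ (q - 1).
have N0 : 0 < N by rewrite powR_gt0// ltr0n.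
pose a j := `|fdiff (zero_ext x) j|.
(* Increments are at most $2t\le1$, which allows raising every exponent to $p^+$ at the end. *)
have a_le1 j : a j <= 1.
  by apply: le_trans (fdiff_zero_ext_le (ltW t0) xt j) _; lra.
have a_sum : 2 * t <= \sum_j a j.
  have := variation_ge (zero_ext x) (interior_node i).
  rewrite zero_ext0 zero_ext_max zero_ext_interior subr0 sub0r normrN xit.
  by rewrite -/(\sum_j a j); lra.
(* Power mean over the $T+1$ increments: the source of $(T+1)^{p^+-1}$. *)
have powsum : (2 * t) `^ q <= N * \sum_j a j `^ q.
  have a_ge0 : 0 <= \sum_j a j by apply: sumr_ge0 => j _; exact: normr_ge0.
  apply: (@le_trans _ _ ((\sum_j a j) `^ q)).
    by apply: ge0_ler_powR => //; rewrite ?nnegrE; lra.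
  have := @powR_sum_le R _ a q q1 _ (fun j => normr_ge0 _).
  by rewrite card_ord => /(_ isT).
apply: (@le_trans _ _ ((\sum_j a j `^ q) / q)).
  rewrite ler_pdivlMr// -(ler_pM2l N0); apply: le_trans powsum.
  rewrite (powRM _ (ler0n _ 2) (ltW t0)) le_eqVlt; apply/orP; left; apply/eqP.
  by field; rewrite !gt_eqF.
rewrite mulr_suml; apply: ler_sum => j _; rewrite -/(a j).
apply: ler_powR_div; first by apply/andP; split;
  [exact: normr_ge0 | exact: a_le1].
  exact: lt_trans ltr01 (pmin_gt1 _).
exact: le_pmax.
Qed.

Lemma dissipation_const_le (c : R) : 0 < c <= 1 ->
  dissipation p (const_mx c) <= 2 / pmin p * c `^ pmin p.
Proof.
move=> /andP[c0 c1]; set q := pmin p; have q0 : 0 < q := lt_trans ltr01 pmin1.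
(* Only the end edges contribute, each at most $c^q/q$ since $c\le1$; the sum of indicators also
   covers the case where these edges coincide. *)
apply: (@le_trans _ _ (\sum_(j < T.+1)
    ((j == ord0)%:R + (j == ord_max)%:R) * (c `^ q / q))).
  apply: ler_sum => j _; rewrite fdiff_zero_ext_const.
  set r := p _; have r1 : 1 < r := pmin_gt1 _; have r0 : 0 < r by lra.
  have qr : q <= r := pmin_le _.
  have cr : c `^ r / r <= c `^ q / q by apply: ler_powR_div;
    rewrite // (ltW c0).
  have cq0 : 0 <= c `^ q / q by rewrite divr_ge0 ?powR_ge0 ?ltW.
  case: (_ == _); case: (_ == _); rewrite /= ?mulr0n ?mulr1n ?subrr ?subr0
    ?sub0r ?mulr0 ?mulr1
    ?mulrN1 ?normrN ?normr0 ?(gtr0_norm c0) ?powR0 ?(gt_eqF r0)//; lra.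
have sum1 k : \sum_(j < T.+1) (j == k)%:R = 1 :> R.
  by rewrite (bigD1 k) //= eqxx big1 ?addr0// => j /negPf ->.
by rewrite -mulr_suml big_split /= !sum1 mulrCA mulrC mulrAC.
Qed.

Lemma normH_zero_ext_le (t : R) (x : 'rV[R]_T) : 0 <= t ->
  (forall i, `|x ord0 i| <= t) -> normH (zero_ext x) <= 2 * T.+1%:R * t.
Proof.
move=> t0 xt; have tT : 0 <= 2 * T.+1%:R * t by rewrite !mulr_ge0.
rewrite -(ger0_norm tT) -sqrtr_sqr ler_sqrt ?sqr_ge0//.
apply: (@le_trans _ _ (\sum_(j < T.+1) (2 * t) ^+ 2)).
  apply: ler_sum => j _; rewrite lerXn2r ?nnegrE ?normr_ge0 ?mulr_ge0//.
  exact: fdiff_zero_ext_le.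
rewrite sumr_const card_ord -[X in X <= _]mulr_natl; set N := T.+1%:R.
have N1 : 1 <= N by rewrite ler1n.
(* The crude $N\le N^2$ is enough: the norm only has to be bounded by a multiple of [t]. *)
have -> : (2 * N * t) ^+ 2 = N * (N * (2 * t) ^+ 2) by ring.
by rewrite ler_pM2l ?ler_peMl ?sqr_ge0//; lra.
Qed.

End Bounds.

(** * From the endpoints of the interval for [lambda] to small solutions *)

Section Endpoints.
Variables (R : realType) (T : nat) (p : 'I_T.+2 -> R) (f : 'I_T -> R -> R).
Hypothesis p1 : 1 < pmin p.
Hypothesis cf : forall i, continuous (f i).

(** $F_k(0)=0$, so each maximum over a ball around 0 is nonnegative. *)
Lemma A0_ge0 : (0 <= A0 p f)%E.
Proof.
rewrite leNgt; apply/negP => A0lt.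
have [t /= /andP[t0 _]] := limf_einf_lt_frequently A0lt (at_right0_itv ltr01).
rewrite lte_fin ltNge => /negP; apply.
rewrite divr_ge0 ?powR_ge0// sumr_ge0// => i _.
rewrite -(primitive00 (f i)) max_ball_ge ?normr0 ?ltW//.
exact: continuous_primitive0.
Qed.

Lemma lambda_right_gt (lambda : R) : 0 < lambda -> (A0 p f < +oo)%E ->
  (lambda%:E < lambda_right p f)%E ->
  (A0 p f < (2 `^ pmax p / (pmax p * T.+1%:R `^ (pmax p - 1)) / lambda)%:E)%E.
Proof.
move=> l0; rewrite /lambda_right; have := A0_ge0.
have K0 : 0 < pmax p * T.+1%:R `^ (pmax p - 1).
  by rewrite mulr_gt0 ?powR_gt0 ?ltr0n// (lt_trans ltr01)// pmax_gt1.
have t0 : (0 : R) < 2 `^ pmax p by rewrite powR_gt0.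
case: (A0 p f) => [a| |] //; rewrite lee_fin le_eqVlt => /predU1P[<- _ _|a0 _].
  (* Here $A_0=0$ and the right endpoint is $+\infty$; the claim is the positivity of a constant. *)
  by rewrite lte_fin !divr_gt0.
have Ka := mulr_gt0 K0 a0.
rewrite -EFinM inver (gt_eqF Ka) -EFinM !lte_fin ltr_pdivlMr// => la.
by rewrite ltr_pdivlMr// ltr_pdivlMr//; lra.
Qed.

Lemma lambda_left_lt (lambda : R) : (0 < B0 p f)%E ->
  (lambda_left p f < lambda%:E)%E ->
  0 < lambda /\ ((2 / pmin p / lambda)%:E < B0 p f)%E.
Proof.
have p0 : 0 < pmin p := lt_trans ltr01 p1.
rewrite /lambda_left; case: (B0 p f) => [b| |] //.
  rewrite lte_fin => b0; rewrite -EFinM inver gt_eqF ?mulr_gt0// -EFinM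
    !lte_fin => bl.
  have l0 : 0 < lambda by apply: lt_trans bl; rewrite divr_gt0 ?mulr_gt0.
  split=> //; move: bl; rewrite ltr_pdivrMr ?mulr_gt0// => bl.
  by rewrite !ltr_pdivrMr//; lra.
(* Here $B^0=+\infty$: the left endpoint is 0, so the hypothesis says exactly $\lambda>0$. *)
have -> : ((pmin p)%:E * +oo = +oo)%E by rewrite gt0_muley// lte_fin.
by move=> _; rewrite invey mule0 lte_fin => l0; rewrite ltry.
Qed.

(** As $\kappa\ge0$, a nonpositive $B^0$ would give $\kappa B^0\le0\le A_0$. *)
Lemma B0_gt0 : (A0 p f < (kappa p)%:E * B0 p f)%E -> (0 < B0 p f)%E.
Proof.
move=> AB; rewrite ltNge; apply/negP => B0le.
have : (0 < (kappa p)%:E * B0 p f)%E := le_lt_trans A0_ge0 AB.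
rewrite ltNge => /negP; apply; rewrite mule_ge0_le0// lee_fin.
have p0 : 0 < pmin p := lt_trans ltr01 p1.
by rewrite /kappa divr_ge0 ?mulr_ge0 ?powR_ge0 ?ltW// (lt_trans ltr01)//
  pmax_gt1.
Qed.

Lemma exists_small_solution (lambda e : R) : 0 < e -> 0 < lambda ->
  (A0 p f < (2 `^ pmax p / (pmax p * T.+1%:R `^ (pmax p - 1)) / lambda)%:E)%E ->
  ((2 / pmin p / lambda)%:E < B0 p f)%E ->
  exists u : 'I_T.+2 -> R, [/\ is_solution p f lambda u,
    exists k, u k != 0 & normH u < e].
Proof.
move=> e0 l0 Alt Bgt; set K := _ / (_ * _) in Alt.
have cF i : continuous (primitive0 (f i)) by apply: continuous_primitive0.
have pgt1 k : 1 < p k := pmin_gt1 p1 k.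
(* Chosen so that the norm bound $2(T+1)t$ falls below [e] once $t<d$. *)
pose d := e / (2 * T.+1%:R);
have T0 : (0 : R) < 2 * T.+1%:R by rewrite mulr_gt0 ?ltr0n.
have d0 : 0 < Num.min d 2^-1 by rewrite lt_min divr_gt0//= invr_gt0.
have [t /= /andP[t0]] := limf_einf_lt_frequently Alt (at_right0_itv d0).
rewrite lt_min => /andP[td t2]; rewrite lte_fin => At.
(* [c] is taken after [t] and below it, so that the constant vector lies in the box. *)
have [c /= /andP[c0 ct]] := limf_esup_gt_frequently Bgt (at_right0_itv t0).
rewrite lte_fin => Bc.
have [x [xt x0 xsol]] : exists x : 'rV[R]_T,
    [/\ forall i, `|x ord0 i| <= t, x != 0
    & is_solution p f lambda (zero_ext x)].
  apply: exists_box_solution => // [x xt xb|].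
    rewrite /energy subr_ge0.
    (* By the choice of [t], on the boundary $\lambda\sum_k F_k(x_k)\le\lambda\sum_k\max_{|\xi|\le
       t}F_k(\xi)\le K\,t^{p^+}$, which the dissipation dominates. *)
    apply: le_trans (dissipation_ge p1 t0 (ltW t2) xt xb); rewrite -/K.
    move: At; rewrite ltr_pdivrMr ?powR_gt0// => /ltW.
    rewrite -(ler_pM2l l0).
    have -> : lambda * (K / lambda * t `^ pmax p) = K * t `^ pmax p.
      by field; rewrite gt_eqF.
    apply: le_trans; rewrite ler_pM2l//; apply: ler_sum => i _;
      exact: max_ball_ge.
  exists (const_mx c) => [i|]; first by rewrite mxE gtr0_norm// ltW.
  have c1 : 0 < c <= 1 by rewrite c0/=; lra.
  (* By the choice of [c], $\lambda\sum_k F_k(c)$ exceeds $(2/p^-)\,c^{p^-}$, which bounds the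
     dissipation. *)
  rewrite /energy subr_lt0; apply: le_lt_trans (dissipation_const_le p1 c1) _.
  have -> : potential f (const_mx c) = \sum_(i < T) primitive0 (f i) c.
    by apply: eq_bigr => i _; rewrite mxE.
  move: Bc; rewrite ltr_pdivlMr ?powR_gt0// -(ltr_pM2l l0).
  by congr (_ < _); field; rewrite !gt_eqF// (lt_trans ltr01).
exists (zero_ext x); split=> //.
  have [i xi] : exists i, x ord0 i != 0.
    apply: contrapT => nex; case/eqP: x0; apply/rowP => i; rewrite mxE.
    by apply/eqP/negPn/negP => xi; apply: nex; exists i.
  by exists (interior_node i); rewrite zero_ext_interior.
apply: le_lt_trans (normH_zero_ext_le (ltW t0) xt) _.
by rewrite mulrC -ltr_pdivlMr.
Qed.

End Endpoints.

Theorem theorem3p1 (R : realType) (T : nat) (hT : (2 <= T)%N)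
    (p : 'I_T.+2 -> R) (hpmin : 1 < pmin p) (hpmax : 1 < pmax p)
    (f : 'I_T -> R -> R) (hf : forall i : 'I_T, continuous (f i))
    (hAB : (A0 p f < (kappa p)%:E * B0 p f)%E)
    (lambda : R)
    (hleft : (lambda_left p f < lambda%:E)%E)
    (hright : (lambda%:E < lambda_right p f)%E) :
  exists u : nat -> ('I_T.+2 -> R),
    [/\ forall n : nat, is_solution p f lambda (u n),
        forall n : nat, exists k : 'I_T.+2, u n k != 0
      & normH (u n) @[n --> \oo] --> (0 : R)].
Proof.
have [l0 Bgt] := lambda_left_lt hpmin (B0_gt0 hpmin hf hAB) hleft.
have Alt := lambda_right_gt hpmin hf l0 (lt_le_trans hAB (leey _)) hright.
(* The norm bounds $1/(n+1)$ tend to 0 and squeeze the norms of the chosen solutions. *)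
have sol n := exists_small_solution hpmin hf (harmonic_gt0 n) l0 Alt Bgt.
have [u uP] := choice sol.
exists u; split=> [n|n|]; try by case: (uP n).
apply: (@squeeze_cvgr _ _ _ _ (cst 0) harmonic _ _ _ (cvg_cst _) cvg_harmonic).
by apply: nearW => n; rewrite /cst sqrtr_ge0 ltW//; case: (uP n).
Qed.
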